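(* Assume $\mathrm{cov}(\mathcal{N})=\mathfrak{c}$. Then there exists a maximal $\mathsf{d}$-independent family $\mathcal{A}$ of cardinality $\mathfrak{c}$ which is not Lebesgue measurable.
   Context: Let $\omega=\{0,1,2,\ldots\}$ and identify $n\in\omega$ with $\{0,\ldots,n-1\}$. $\mathcal{D}$ is the family of all $A\subseteq\omega$ for which the asymptotic density $\mathsf{d}(A):=\lim_{n\to\infty}|A\cap n|/n$ exists. For $\mathcal{A}\subseteq\mathcal{P}(\omega)$, $\langle\mathcal{A}\rangle$ denotes the field of subsets of $\omega$ generated by $\mathcal{A}$. A nonempty family $\mathcal{A}\subseteq\mathcal{D}$ is $\mathsf{d}$-independent if: (1) $\mathsf{d}(A)\in(0,1)$ for all $A\in\mathcal{A}$; (2) $\langle\mathcal{A}\rangle\subseteq\mathcal{D}$; (3) $\mathsf{d}(\bigcap\mathcal{F})=\prod_{A\in\mathcal{F}}\mathsf{d}(A)$ for every nonempty finite $\mathcal{F}\subseteq\mathcal{A}$. It is a maximal $\mathsf{d}$-independent family if it is $\mathsf{d}$-independent and not properly contained in another $\mathsf{d}$-independent family. Subsets of $\omega$ are identified with their characteristic functions in $2^\omega$ (equivalently for this purpose, an infinite $A\subseteq\omega$ is identified with the real $\sum_{n\in A}2^{-n-1}\in(0,1]$, with Lebesgue measure there). $\lambda$ denotes the completion of the usual product probability measure on $2^\omega$, and ''Lebesgue measurable'' means $\lambda$-measurable. $\mathcal{N}$ is the family of subsets of $2^\omega$ that are $\lambda$-null; $\mathrm{cov}(\mathcal{N})$ is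 the least cardinality of a family $\mathcal{S}\subseteq\mathcal{N}$ with $\bigcup\mathcal{S}=2^\omega$. $\mathfrak{c}=2^{\aleph_0}$. *)

(* Defs.v *)
From HB Require Import structures.
From mathcomp Require Import all_boot all_order all_algebra finmap.
From mathcomp Require Import all_classical all_reals all_analysis.
From mathcomp Require Import measurable_realfun.

Set Implicit Arguments.
Unset Strict Implicit.
Unset Printing Implicit Defensive.

Import Order.TTheory GRing.Theory Num.Theory.
Import numFieldNormedType.Exports.

Local Open Scope classical_set_scope.
Local Open Scope ring_scope.

Definition field_of_sets {T} (G : set (set T)) :=
  [/\ G setT, setC_closed G & setU_closed G].

Section density.
Variable R : realType.
Implicit Types (A : set nat) (AA BB : set (set nat)).

Definition density_seq A : R^nat :=
  fun n => #|[pred k : 'I_n | (k : nat) \in A]|%:R / n%:R.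

Definition has_density : set (set nat) :=
  [set A | cvgn (density_seq A)].

(* Meaningful only for [A] in [has_density]: [limn] is total. *)
Definition density A : R := limn (density_seq A).

Definition d_independent AA :=
  [/\ AA !=set0,
      AA `<=` has_density,
      forall A, AA A -> 0 < density A < 1,
      smallest field_of_sets AA `<=` has_density &
      forall F : {fset set nat}, F != fset0 -> [set` F] `<=` AA ->
        density (\bigcap_(A in [set` F]) A) = \prod_(A <- F) density A].

Definition maximal_d_independent AA :=
  d_independent AA /\ ~ exists2 BB, d_independent BB & AA `<` BB.

End density.

(* [A] depends only on the coordinates below [n]; such sets are the clopen
   subsets of the Cantor space. *)
Definition determined n (A : set cantor_space) :=
  forall x y, (forall k, (k < n)%N -> x k = y k) -> A x -> A y.

Lemma determined_le m n A : (m <= n)%N -> determined m A -> determined n A.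
Proof.
by move=> mn mA x y xy; apply: mA => k km; apply: xy; exact: leq_trans mn.
Qed.

Lemma determinedE n A x y : determined n A ->
  (forall k, (k < n)%N -> x k = y k) -> (x \in A) = (y \in A).
Proof.
move=> nA xy; apply/idP/idP; rewrite !inE; apply: (nA) => // k kn.
by rewrite xy.
Qed.

Definition finitely_determined : set (set cantor_space) :=
  [set A | exists n, determined n A].

Lemma finitely_determined0 : finitely_determined set0.
Proof. by exists 0%N. Qed.

Lemma finitely_determinedU : setU_closed finitely_determined.
Proof.
move=> A B [m mA] [n nB]; exists (maxn m n) => x y xy [Ax|Bx]; [left|right].
- by apply: determined_le mA _ _ xy Ax; exact: leq_maxl.
- by apply: determined_le nB _ _ xy Bx; exact: leq_maxr.
Qed.

Lemma finitely_determinedC : setC_closed finitely_determined.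
Proof.
move=> A [n nA]; exists n => x y xy /= Ax Ay; apply: Ax.
by apply: nA Ay => k kn; rewrite xy.
Qed.

Definition clopen_cantor : Type := cantor_space.
HB.instance Definition _ := Pointed.on clopen_cantor.

Definition clopen_display : measure_display.
Proof. exact: default_measure_display. Qed.

HB.instance Definition _ := isAlgebraOfSets.Build clopen_display clopen_cantor
  finitely_determined0 finitely_determinedU finitely_determinedC.

Section product_measure.
Variable R : realType.
Implicit Types A B : set clopen_cantor.

(* Proportion of the 0/1-words of length [n] that, continued by zeros, belong
   to [A]. *)
Definition word_ratio n A : R :=
  #|[pred s : n.-tuple bool | (nth false s : cantor_space) \in A]|%:R / 2 ^+ n.

(* If [A] is finitely determined, [word_ratio n A] is the same for all [n] such
   that [determined n A] (see [clopen_measureE]). *)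
Definition clopen_measure A : \bar R :=
  (word_ratio (xget 0%N [set n | determined n A]) A)%:E.

Lemma word_ratioS n A : determined n A -> word_ratio n.+1 A = word_ratio n A.
Proof.
move=> nA; rewrite /word_ratio.
pose P m (s : m.-tuple bool) := (nth false s : cantor_space) \in A.
have Pr (t : n.-tuple bool) b : P n.+1 [tuple of rcons t b] = P n t.
  by apply: (determinedE nA) => k kn; rewrite /= nth_rcons size_tuple kn.
have -> : #|[pred s : n.+1.-tuple bool | P n.+1 s]| =
          (#|[pred s : n.-tuple bool | P n s]| * 2)%N.
  rewrite -!sum1_card.
  pose h (p : n.-tuple bool * bool) := [tuple of rcons p.1 p.2].
  have hbij : {on [pred s | P n.+1 s], bijective h}.
    exists (fun s => ([tuple of belast (thead s) (behead s)],
                      last (thead s) (behead s))) => /=.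
      move=> [t b] _ /=; congr pair; last first.
        by case: t => -[|x t] //= i; rewrite /thead (tnth_nth false)/= last_rcons.
      apply: val_inj => /=; case: t => -[|x t] //= i.
      by rewrite /thead (tnth_nth false)/= belast_rcons.
    move=> s _; apply: val_inj => /=.
    by rewrite -lastI [in RHS](tuple_eta s).
  rewrite (reindex h)//=.
  rewrite (eq_bigl (fun p => P n p.1 && xpredT p.2)); last first.
    by move=> [t b]; rewrite inE/= Pr andbT.
  rewrite -(pair_big (fun t => P n t) xpredT (fun _ _ => 1%N))/=.
  under eq_bigr do rewrite sum1_card card_bool.
  by rewrite big_distrl/=; apply: eq_bigr.
by rewrite natrM exprSr -mulf_div divff ?mulr1// pnatr_eq0.
Qed.

Lemma word_ratio_le m n A : determined m A -> (m <= n)%N ->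
  word_ratio n A = word_ratio m A.
Proof.
move=> mA /subnK <-; elim: (n - m)%N => [|k ih]; first by [].
by rewrite addSn word_ratioS//; apply: determined_le mA; exact: leq_addl.
Qed.

Lemma clopen_measureE n A : determined n A ->
  clopen_measure A = (word_ratio n A)%:E.
Proof.
move=> nA; rewrite /clopen_measure; case: xgetP => [m _ mA|/(_ n)//].
congr EFin; rewrite -(word_ratio_le mA (leq_maxl m n)).
by rewrite (word_ratio_le nA (leq_maxr m n)).
Qed.

Lemma clopen_measure0 : clopen_measure set0 = 0%E.
Proof.
rewrite (@clopen_measureE 0%N)// /word_ratio eq_card0 ?mul0r// => s.
by rewrite inE in_set0.
Qed.

Lemma clopen_measure_ge0 A : (0 <= clopen_measure A)%E.
Proof. by rewrite lee_fin divr_ge0// exprn_ge0. Qed.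

Lemma clopen_measureU A B : measurable A -> measurable B -> A `&` B = set0 ->
  clopen_measure (A `|` B) = (clopen_measure A + clopen_measure B)%E.
Proof.
move=> [m mA] [n nB] AB0; set k := maxn m n.
have kA : determined k A by apply: determined_le mA; exact: leq_maxl.
have kB : determined k B by apply: determined_le nB; exact: leq_maxr.
have kAB : determined k (A `|` B).
  by move=> x y xy [?|?]; [left; apply: kA xy _|right; apply: kB xy _].
rewrite (clopen_measureE kA) (clopen_measureE kB) (clopen_measureE kAB).
rewrite -EFinD /word_ratio -mulrDl -natrD; congr ((_%:R / _)%:E).
rewrite -cardUI [X in (_ + X)%N]eq_card0 ?addn0.
  by apply: eq_card => s; rewrite !inE in_setU.
move=> s; rewrite !inE; apply/negP => /andP[]; rewrite !inE => As Bs.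
by have : (A `&` B) (nth false s); [split|rewrite AB0].
Qed.

Lemma clopen_measure_bigcup (F : (set clopen_cantor)^nat) n :
  (forall i, measurable (F i)) -> trivIset setT F ->
  clopen_measure (\big[setU/set0]_(i < n) F i) =
  (\sum_(i < n) clopen_measure (F i))%E.
Proof.
move=> mF tF; elim: n => [|n ih]; first by rewrite !big_ord0 clopen_measure0.
rewrite !big_ord_recr/= clopen_measureU ?ih//.
- by elim/big_ind: _ => //; exact: finitely_determinedU.
- by apply: (@trivIset_bigsetUI _ xpredT F) => //; exact: sub_trivIset tF.
Qed.

Lemma finitely_determined_open (A : set cantor_space) :
  finitely_determined A -> open A.
Proof.
move=> [n nA]; rewrite openE => x Ax.
suff : nbhs x [set y : cantor_space | forall k, (k < n)%N -> y k = x k].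
  by apply: filterS => y xy; apply: (nA x y _ Ax) => k kn; exact/esym/xy.
elim: n {nA} => [|n ih]; first by apply: filterS filterT => y _ k.
have xn : nbhs x [set y : cantor_space | y n = x n].
  have /(_ x [set x n]) := @proj_continuous nat (fun=> bool) n.
  by apply.
apply: filterS (filterI ih xn) => y /= [yx yn] k.
by rewrite ltnS leq_eqVlt => /orP[/eqP ->//|]; exact: yx.
Qed.

Lemma clopen_measure_semi_sigma_additive :
  semi_sigma_additive clopen_measure.
Proof.
move=> F mF tF mUF.
have [N NF] : exists N, forall i, (N <= i)%N -> F i = set0.
  have : @compact cantor_space (\bigcup_i F i).
    apply: subclosed_compact cantor_space_compact _ => //.
    rewrite -openC; apply: finitely_determined_open.
    exact: finitely_determinedC.
  rewrite compact_cover => /(_ _ setT F).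
  case => // [i _|D _ UD]; first by apply: finitely_determined_open; exact: mF.
  exists (\max_(i <- enum_fset D) i).+1 => i Di.
  apply/seteqP; split => // x Fix.
  have [j /= jD Fjx] := UD x (ex_intro2 _ _ i I Fix).
  have ij : i = j by apply: tF => //; exists x.
  by move: Di; rewrite ltnNge ij leq_bigmax_seq.
have UFE n : (N <= n)%N -> \big[setU/set0]_(i < n) F i = \bigcup_i F i.
  move=> Nn; rewrite -bigcup_mkord; apply/seteqP; split.
    by move=> x [i _ Fix]; exists i.
  move=> x [i _ Fix]; exists i => //=; rewrite ltnNge; apply/negP => ni.
  by move: Fix; rewrite NF// (leq_trans Nn).
apply: cvg_near_cst; exists N => // n /= Nn.
by rewrite big_mkord -clopen_measure_bigcup// UFE.
Qed.

HB.instance Definition _ := isMeasure.Build _ _ _ clopen_measure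
  clopen_measure0 clopen_measure_ge0 clopen_measure_semi_sigma_additive.

(* The product sigma-algebra is generated by the finitely determined sets. *)
Definition cantor_measure :
    {measure set (g_sigma_algebraType (@measurable _ clopen_cantor)) -> \bar R} :=
  measure_extension clopen_measure.

Definition cylinder (s : seq bool) : set cantor_space :=
  [set x | forall k, (k < size s)%N -> x k = nth false s k].

Lemma cantor_measure_cylinder s :
  cantor_measure (cylinder s) = (2 ^- size s)%:E.
Proof.
have ds : determined (size s) (cylinder s).
  by move=> x y xy sx k ks; rewrite -xy// sx.
rewrite /cantor_measure/= /measure_extension measurable_mu_extE/=; last first.
  by exists (size s).
rewrite (clopen_measureE ds) /word_ratio (_ : #|_| = 1%N) ?mul1r//.
rewrite -(card1 (in_tuple s)); apply: eq_card => t; rewrite !inE.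
apply/idP/eqP => [|->]; rewrite inE//= => st; apply: val_inj => /=.
by apply: (@eq_from_nth _ false); rewrite size_tuple// => i; exact: st.
Qed.

(* A set is null (resp. measurable) for the completion of a measure iff it is
   negligible for the measure (resp. the union of a measurable set and a
   negligible one). *)
Definition cantor_null : set (set cantor_space) :=
  cantor_measure.-negligible.

Definition cantor_lebesgue_measurable : set (set cantor_space) :=
  completed_algebra_gen cantor_measure.

Definition null_cover (S : set (set cantor_space)) :=
  S `<=` cantor_null /\ \bigcup_(X in S) X = setT.

(* Cardinals are not first-class objects in the library: that a cardinal equals
   cov(N) is stated for a set [K] representing it. *)
Definition card_is_cov_null T (K : set T) :=
  (exists2 S, null_cover S & (S #= K)%card) /\
  (forall S, null_cover S -> (K #<= S)%card).

End product_measure.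

(* The identification of the subsets of omega with the points of 2^omega. *)
Definition charfun (A : set nat) : cantor_space := fun n => n \in A.

(* The representative of the cardinal 2^aleph_0. *)
Definition continuum : set (nat -> bool) := setT.

(* Main.v *)
Require Import Defs.
From mathcomp Require Import all_boot all_order all_algebra finmap.
From mathcomp Require Import all_classical all_reals all_analysis.
From mathcomp Require Import wochoice ring lra.

(** By transfinite recursion along a well-order of size c, choose sets [f i] such that
    [f i] avoids the [i]-th null G_delta set and, for every finite intersection
    [B] of earlier choices, [f i] contains asymptotically half of [B].  By the
    strong law of large numbers each of these requirements only excludes a null
    set, so cov(N) = c leaves a candidate at every stage.  The range of [f] is
    then d-independent, of cardinality c and not null; Zorn's lemma extends it
    to a maximal family [AA].

    A Lebesgue measurable d-independent family is null: two distinct members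
    cannot differ at only finitely many places, so the images of the family
    under the maps flipping one coordinate are infinitely many pairwise disjoint
    sets of the same measure.  Hence [AA] is not measurable. *)

Set Implicit Arguments.
Unset Strict Implicit.
Unset Printing Implicit Defensive.

Import Order.TTheory GRing.Theory Num.Theory.
Import numFieldNormedType.Exports.

Local Open Scope classical_set_scope.
Local Open Scope ring_scope.

(** * Independence for the asymptotic density *)

Section density.
Variable R : realType.
Implicit Types (A B : set nat) (AA : set (set nat)).

Definition cvg_density A (a : R) := density_seq R A @ \oo --> a.

Lemma cvg_densityE A a : cvg_density A a -> density R A = a.
Proof. by move=> Aa; apply: cvg_lim. Qed.

Lemma cvg_density_has A a : cvg_density A a -> has_density R A.
Proof. by move=> Aa; apply/cvg_ex; exists a. Qed.

Lemma cvg_density_density A : has_density R A -> cvg_density A (density R A).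
Proof. by []. Qed.

Lemma density_seqE A n :
  density_seq R A n = (\sum_(k < n) ((k : nat) \in A)%:R) / n%:R.
Proof.
congr (_ / _); rewrite -sum1_card natr_sum [RHS]big_mkcond/= big_mkcond/=.
by apply: eq_bigr => k _; rewrite inE/= unfold_in; case: ifP => //; case: ifP.
Qed.

Lemma cvg_densityT : cvg_density setT 1.
Proof.
apply: cvg_near_cst; near=> n.
rewrite density_seqE (eq_bigr (fun=> 1))//; last by move=> k _; rewrite in_setT.
rewrite sumr_const card_ord divff// pnatr_eq0 -lt0n.
by near: n; exists 1%N.
Unshelve. all: by end_near. Qed.

Lemma cvg_densityD A B a b : B `<=` A ->
  cvg_density A a -> cvg_density B b -> cvg_density (A `\` B) (a - b).
Proof.
move=> BA Aa Bb; rewrite /cvg_density.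
have -> : density_seq R (A `\` B) = density_seq R A \- density_seq R B.
  apply/funext => n /=; rewrite !density_seqE -mulrBl -sumrB; congr (_ / _).
  apply: eq_bigr => k _; rewrite in_setD.
  case: (boolP ((k : nat) \in B)) => kB.
    have -> : (k : nat) \in A by rewrite inE; apply: BA; rewrite inE in kB.
    by rewrite andbF subrr.
  by rewrite andbT subr0.
exact: cvgB.
Qed.

(** The counts below [n] differ by at most [N], and [N / n] tends to 0. *)
Lemma cvg_density_eventually N A B a :
  (forall k, (N <= k)%N -> (k \in A) = (k \in B)) ->
  cvg_density A a -> cvg_density B a.
Proof.
move=> AB Aa.
have dAB : (density_seq R B \- density_seq R A) n @[n --> \oo] --> (0 : R).
  apply/norm_cvg0P.
  apply: (@squeeze_cvgr _ _ _ _ (cst 0) (fun n => N%:R / n%:R)).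
  - near=> n; rewrite normr_ge0/= !density_seqE -mulrBl -sumrB normrM normfV.
    rewrite (ger0_norm (ler0n _ n)) ler_wpM2r ?invr_ge0//.
    have Nn : (N <= n)%N by near: n; exists N.
    rewrite (bigID (fun k : 'I_n => (k < N)%N))/= [X in _ + X]big1 ?addr0.
      apply: le_trans (ler_norm_sum _ _ _) _.
      apply: (@le_trans _ _ (\sum_(k < n | (k < N)%N) 1)).
        apply: ler_sum => k _.
        by do 2 case: (_ \in _); rewrite ?subrr ?subr0 ?sub0r ?normrN ?normr0 ?normr1.
      by rewrite -(big_ord_widen _ (fun=> 1) Nn) sumr_const card_ord.
    by move=> k; rewrite -leqNgt => Nk; rewrite AB// subrr.
  - exact: cvg_cst.
  - rewrite -(mulr0 N%:R); apply: cvgM; first exact: cvg_cst.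
    by rewrite -cvg_shiftS; exact: cvg_harmonic.
rewrite /cvg_density -(add0r a).
have -> : density_seq R B =
    (density_seq R B \- density_seq R A) \+ density_seq R A.
  by apply/funext => n /=; rewrite subrK.
exact: cvgD.
Unshelve. all: by end_near. Qed.

Definition fcap (F : {fset set nat}) : set nat := \bigcap_(A in [set` F]) A.

(* A property of finite character, equivalent to [d_independent] for nonempty
   families (see [indepP]). *)
Definition indep AA := (forall A, AA A -> 0 < density R A < 1) /\
  forall F : {fset set nat}, [set` F] `<=` AA ->
    cvg_density (fcap F) (\prod_(A <- F) density R A).

Lemma fcap0 : fcap fset0 = setT.
Proof. by rewrite /fcap set_fset0 bigcap_set0. Qed.

Lemma fcap1 A : fcap [fset A]%fset = A.
Proof. by rewrite /fcap set_fset1 bigcap_set1. Qed.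

Lemma fcapU F G : fcap (F `|` G)%fset = fcap F `&` fcap G.
Proof. by rewrite /fcap set_fsetU bigcap_setU. Qed.

(** This is the finitary analogue of a generated lambda-system. Proper differences preserve the
    existence of the density, whereas unions need not. *)
Inductive field_closure (P : set (set nat)) : set (set nat) :=
| field_closure_base A : P A -> field_closure P A
| field_closureT : field_closure P setT
| field_closureD A B : B `<=` A -> field_closure P A -> field_closure P B ->
    field_closure P (A `\` B).

(* The finitary pi-lambda theorem. *)
Lemma field_closure_setI P : setI_closed P -> setI_closed (field_closure P).
Proof.
move=> PI.
have PL A B : P B -> field_closure P A -> field_closure P (A `&` B).
  move=> PB; elim=> {A}[A PA||A C CA _ IA _ IC].
  - by apply: field_closure_base; apply: PI.
  - by rewrite setTI; apply: field_closure_base.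
  - have -> : (A `\` C) `&` B = (A `&` B) `\` (C `&` B).
      by apply/seteqP; split=> k /=; tauto.
    by apply: field_closureD => //; apply: setSI.
move=> A B LA; elim=> {B}[B PB||B C CB _ IB _ IC].
- exact: PL.
- by rewrite setIT.
- have -> : A `&` (B `\` C) = (A `&` B) `\` (A `&` C).
    by apply/seteqP; split=> k /=; tauto.
  by apply: field_closureD => //; apply: setIS.
Qed.

Lemma field_closure_field P : setI_closed P -> field_of_sets (field_closure P).
Proof.
move=> PI; have LC : setC_closed (field_closure P).
  by move=> A LA; rewrite -setTD; apply: field_closureD => //; exact: field_closureT.
split=> //; first exact: field_closureT.
move=> A B LA LB; rewrite -[_ `|` _]setCK setCU; apply: (LC).
by apply: field_closure_setI => //; exact: LC.
Qed.

Lemma indep_density AA A : indep AA -> AA A -> cvg_density A (density R A).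
Proof.
move=> [_ /(_ [fset A]%fset)]; rewrite fcap1 big_seq_fset1 => + AAA; apply.
by move=> B /=; rewrite inE => /eqP ->.
Qed.

(** Finite intersections lie in the generated field, so their densities exist. Conversely they form
    a pi-system, whose closure under proper differences is a field on which densities exist by
    induction. *)
Lemma indepP AA : d_independent R AA <-> AA !=set0 /\ indep AA.
Proof.
split=> [[AA0 AAD AA01 fAA dAA]|[AA0 [AA01 dAA]]].
  split=> //; split=> // F FAA; have [->|F0] := eqVneq F fset0.
    by rewrite fcap0 big_seq_fset0; exact: cvg_densityT.
  rewrite -dAA//; apply: cvg_density_density; apply: fAA => G [[GT GC GU] AAG].
  have : [set` F] `<=` G by exact: subset_trans AAG.
  rewrite /fcap; elim/fset1U_rect: F {F0 FAA} => //= [_|A F AF IF FG].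
    by rewrite set_fset0 bigcap_set0.
  rewrite set_fsetU bigcap_setU -[_ `&` _]setCK setCI; apply: (GC).
  apply: GU; apply: GC.
    by rewrite set_fset1 bigcap_set1; apply: FG; rewrite /= fset1U1.
  by apply: IF => B BF; apply: FG; rewrite /= in_fsetU BF orbT.
split=> //.
- by move=> A AAA; apply: cvg_density_has (indep_density (conj AA01 dAA) AAA).
- pose P := [set fcap F | F in [set F : {fset set nat} | [set` F] `<=` AA]].
  have PI : setI_closed P.
    move=> _ _ [F FAA <-] [G GAA <-]; exists (F `|` G)%fset; last exact: fcapU.
    by rewrite /= set_fsetU subUset.
  apply: (@subset_trans _ (field_closure P)).
    apply: smallest_sub; first exact: field_closure_field.
    move=> A AAA; apply: field_closure_base; exists [fset A]%fset.
      by move=> B /=; rewrite inE => /eqP ->.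
    by rewrite fcap1.
  move=> A; elim=> {A}[A [F FAA <-]||A B BA _ hA _ hB].
  + exact: cvg_density_has (dAA _ FAA).
  + exact: cvg_density_has cvg_densityT.
  + exact: cvg_density_has (cvg_densityD BA hA hB).
- by move=> F _ FAA; apply: cvg_densityE; exact: dAA.
Qed.

Lemma indep0 : indep set0.
Proof.
split=> // F; rewrite subset0 => F0.
have -> : F = fset0 by apply/fsetP => A; apply/negP => AF; rewrite -[False]/(set0 A) -F0.
by rewrite fcap0 big_seq_fset0; exact: cvg_densityT.
Qed.

Lemma fset_bigcup_chain (C : set (set (set nat))) (F : {fset set nat}) :
  C !=set0 -> total_on C subset ->
  [set` F] `<=` \bigcup_(X in C) X -> exists2 X, C X & [set` F] `<=` X.
Proof.
move=> [X0 CX0] Ctot; elim/fset1U_rect: F => [_|A F AF IF AFC].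
  by exists X0 => //; rewrite set_fset0.
have [|X CX FX] := IF.
  by move=> B BF; apply: AFC; rewrite /= in_fsetU BF orbT.
have [|Y CY YA] := AFC A; first by rewrite /= fset1U1.
have [XY|YX] := Ctot _ _ CX CY.
  exists Y => // B /=; rewrite in_fsetU in_fset1 => /orP[/eqP ->//|BF].
  by apply: XY; apply: FX.
exists X => // B /=; rewrite in_fsetU in_fset1 => /orP[/eqP ->//|BF].
  exact: YX.
exact: FX.
Qed.

Lemma indep_bigcup (C : set (set (set nat))) :
  total_on C subset -> (forall X, C X -> indep X) -> indep (\bigcup_(X in C) X).
Proof.
move=> Ctot Ci; have [->|/set0P C0] := eqVneq C set0.
  by rewrite bigcup_set0; exact: indep0.
split=> [A [X CX XA]|F /(fset_bigcup_chain C0 Ctot)[X CX FX]].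
  exact: (Ci X CX).1.
exact: (Ci X CX).2.
Qed.

(** A finite intersection involving [A] is [A] met with an intersection from [AA], so the hypothesis
    supplies one factor 1/2. The case of empty [F] shows that this factor is the density of [A]. *)
Lemma indep_extend AA A : indep AA ->
  (forall F, [set` F] `<=` AA ->
    cvg_density (A `&` fcap F) (density R (fcap F) / 2)) ->
  indep (A |` AA).
Proof.
move=> [AA01 dAA] AF.
have dA : cvg_density A (1 / 2).
  have := AF fset0; rewrite fcap0 setIT (cvg_densityE cvg_densityT); apply.
  by rewrite set_fset0.
split=> [B [->|//]|F FAA]; first by rewrite (cvg_densityE dA); lra.
  exact: AA01.
have [AinF|AF'] := boolP (A \in F); last first.
  apply: dAA => B BF; have [/= BA|//] := FAA _ BF.
  by move: AF'; rewrite -BA; move: BF => /= ->.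
have FAA' : [set` (F `\ A)%fset] `<=` AA.
  move=> B /=; rewrite in_fsetD1 => /andP[BA BF].
  by have [/= BA'|//] := FAA _ BF; rewrite BA' eqxx in BA.
rewrite -(fsetD1K AinF) fcapU fcap1 big_fsetU1/=; last by rewrite !inE eqxx.
rewrite (cvg_densityE dA) mul1r mulrC -(cvg_densityE (dAA _ FAA')).
exact: AF.
Qed.

Lemma indep_maximal base : base !=set0 -> indep base ->
  exists2 AA, maximal_d_independent R AA & base `<=` AA.
Proof.
move=> base0 ibase.
(* Zorn's lemma is applied to the sets to be added to [base], so that the union of the empty chain
   is also admissible. *)
have [|X [/= iX Xmax]] := @Zorn_bigcup _ [set X | indep (base `|` X)].
- move=> C CP Ctot; have [->|/set0P C0] := eqVneq C set0.
    by rewrite /= bigcup_set0 setU0.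
  rewrite /= (_ : base `|` \bigcup_(X in C) X =
      \bigcup_(Y in [set base `|` X | X in C]) Y).
    apply: indep_bigcup => [_ _ [X CX <-] [Y CY <-]|_ [X CX <-]].
      by have [XY|YX] := Ctot _ _ CX CY; [left|right]; apply: setUS.
    exact: CP.
  apply/seteqP; split=> [A [bA|[X CX XA]]|A [_ [X CX <-] [bA|XA]]].
  - by have [X CX] := C0; exists (base `|` X); [exists X|left].
  - by exists (base `|` X); [exists X|right].
  - by left.
  - by right; exists X.
exists (base `|` X); last exact: subsetUl.
split; first by apply/indepP; split=> //; have [A bA] := base0; exists A; left.
move=> [BB /indepP[_ iBB] [sBB nBB]]; have bBB : base `|` BB = BB.
  by apply/setUidr => A bA; apply: sBB; left.
apply: (Xmax BB); last by rewrite /= bBB.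
split=> [A XA|BX]; first by apply: sBB; right.
by apply: nBB => A /BX; right.
Qed.

Lemma indepI AA A B : indep AA -> AA A -> AA B -> A != B ->
  cvg_density (A `&` B) (density R A * density R B).
Proof.
move=> [_ dAA] AAA AAB AB; have := dAA [fset A; B]%fset.
rewrite fcapU !fcap1 big_fsetU1 ?in_fset1// big_seq_fset1; apply.
by move=> C /=; rewrite !inE => /orP[] /eqP ->.
Qed.

(** Otherwise the intersection would have the density of [A], so d(A) = d(A) d(B), against d(A) > 0
    and d(B) < 1. *)
Lemma indep_neq_eventually AA A B N : indep AA -> AA A -> AA B -> A != B ->
  ~ (forall k, (N <= k)%N -> (k \in A) = (k \in B)).
Proof.
move=> iAA AAA AAB neqAB AB.
have /cvg_densityE dI : cvg_density (A `&` B) (density R A).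
  apply: (@cvg_density_eventually N A) => [k Nk|].
    by rewrite in_setI -AB// andbb.
  exact: indep_density iAA AAA.
have := cvg_densityE (indepI iAA AAA AAB neqAB); rewrite dI.
have [/(_ _ AAA)/andP[A0 _] /(_ _ AAB)/andP[_ B1]] := (iAA.1, iAA.1).
by nra.
Qed.

End density.

(** * Null sets of the Cantor space *)

Section cantor_measure_theory.
Variable R : realType.
Implicit Types (A : set cantor_space) (B : set nat).

Notation mu := (cantor_measure R).
Notation cantor_sigma := (g_sigma_algebraType (@measurable _ clopen_cantor)).

Lemma determined_measurable n A : determined n A ->
  measurable (A : set cantor_sigma).
Proof. by move=> nA; apply: sub_sigma_algebra; exists n. Qed.

Lemma cantor_measure_determined n A : determined n A ->
  mu A = (word_ratio R n A)%:E.
Proof.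
move=> nA; rewrite /cantor_measure/= /measure_extension measurable_mu_extE/=.
  exact: clopen_measureE.
by exists n.
Qed.

Lemma cantor_measureT : mu setT = 1%E.
Proof.
have -> : [set: cantor_space] = cylinder [::] by apply/seteqP; split.
by rewrite cantor_measure_cylinder expr0 invr1.
Qed.

Lemma cantor_null0 : cantor_null R set0.
Proof. exact: negligible_set0. Qed.

Lemma cantor_null_setU A A' :
  cantor_null R A -> cantor_null R A' -> cantor_null R (A `|` A').
Proof. exact: negligibleU. Qed.

Lemma cantor_nullS A A' : A `<=` A' -> cantor_null R A' -> cantor_null R A.
Proof.
move=> AA' [N [mN N0 A'N]]; exists N; split => //; exact: subset_trans A'N.
Qed.

(** * Strong law of large numbers for random signs along a set *)

Definition rademacher (b : bool) : R := if b then 1 else -1.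

Definition rademacher_sum B n (x : cantor_space) : R :=
  \sum_(k < n | (k : nat) \in B) rademacher (x k).

Lemma rademacher_sum_rcons B n (s : n.-tuple bool) b :
  rademacher_sum B n.+1 (nth false (rcons s b)) =
  rademacher_sum B n (nth false s) + (n \in B)%:R * rademacher b.
Proof.
rewrite /rademacher_sum big_mkcond big_ord_recr/= -big_mkcond/=.
congr (_ + _); last first.
  by rewrite nth_rcons size_tuple ltnn eqxx; case: ifP; rewrite ?mul1r ?mul0r.
by apply: eq_bigr => k _; rewrite nth_rcons size_tuple ltn_ord.
Qed.

Lemma sum_tuple_rcons n (f : seq bool -> R) :
  \sum_(s : n.+1.-tuple bool) f s =
  \sum_(s : n.-tuple bool) (f (rcons s true) + f (rcons s false)).
Proof.
pose h (p : n.-tuple bool * bool) := [tuple of rcons p.1 p.2].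
have hbij : bijective h.
  exists (fun s => ([tuple of belast (thead s) (behead s)],
                    last (thead s) (behead s))) => /=.
    move=> [t b] /=; congr pair; last first.
      by case: t => -[|x t] //= i; rewrite /thead (tnth_nth false)/= last_rcons.
    apply: val_inj => /=; case: t => -[|x t] //= i.
    by rewrite /thead (tnth_nth false)/= belast_rcons.
  by move=> s; apply: val_inj => /=; rewrite -lastI [in RHS](tuple_eta s).
rewrite (reindex h)/=; last exact: onW_bij.
rewrite -(pair_bigA _ (fun (t : n.-tuple bool) b => f (rcons t b)))/=.
by apply: eq_bigr => t _; rewrite big_bool.
Qed.

(** The cross terms of [(S + 1)^2 + (S - 1)^2] cancel, so the mean square over all words grows by at
    most 1 per letter. *)
Lemma rademacher_moment2 B n :
  \sum_(s : n.-tuple bool) rademacher_sum B n (nth false s) ^+ 2 <=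
  n%:R * 2 ^+ n.
Proof.
elim: n => [|n ih].
  by rewrite mul0r big1// => s _; rewrite /rademacher_sum big_ord0 expr0n.
rewrite (sum_tuple_rcons _ (fun s => rademacher_sum B n.+1 (nth false s) ^+ 2)).
under eq_bigr do rewrite !rademacher_sum_rcons/=.
apply: (@le_trans _ _ (\sum_(s : n.-tuple bool)
    (2 * rademacher_sum B n (nth false s) ^+ 2 + 2))).
  by apply: ler_sum => s _; case: (n \in B) => /=; nra.
rewrite big_split/= -mulr_sumr sumr_const card_tuple card_bool.
rewrite -[_ *+ (2 ^ n)]mulr_natr natrX.
by rewrite exprS -natr1; nra.
Qed.

(** Since [(S + 1)^4 + (S - 1)^4 = 2 S^4 + 12 S^2 + 2], the second moment bound lets the mean grow
    by at most [6 n + 1] per letter, and [3 n^2 + 6 n + 1 <= 3 (n + 1)^2]. *)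
Lemma rademacher_moment4 B n :
  \sum_(s : n.-tuple bool) rademacher_sum B n (nth false s) ^+ 4 <=
  3 * n%:R ^+ 2 * 2 ^+ n.
Proof.
elim: n => [|n ih].
  rewrite expr0n mulr0 mul0r big1// => s _.
  by rewrite /rademacher_sum big_ord0 expr0n.
rewrite (sum_tuple_rcons _ (fun s => rademacher_sum B n.+1 (nth false s) ^+ 4)).
under eq_bigr do rewrite !rademacher_sum_rcons/=.
apply: (@le_trans _ _ (\sum_(s : n.-tuple bool)
    (2 * rademacher_sum B n (nth false s) ^+ 4 +
     (12 * rademacher_sum B n (nth false s) ^+ 2 + 2)))).
  apply: ler_sum => s _; set S := rademacher_sum _ _ _.
  have S2 := sqr_ge0 S.
  case: (n \in B) => /=; last by rewrite !mul0r addr0; lra.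
  by rewrite !mul1r le_eqVlt; apply/orP; left; apply/eqP; ring.
rewrite !big_split/= -!mulr_sumr sumr_const card_tuple card_bool.
rewrite -[_ *+ (2 ^ n)]mulr_natr natrX.
have := rademacher_moment2 B n; have n0 := ler0n R n.
have e0 : 0 <= 2 ^+ n :> R by rewrite exprn_ge0.
rewrite [2 ^+ n.+1]exprS -[n.+1%:R]natr1; move: ih e0 n0.
set a := \sum_(_ | _) _; set b := \sum_(_ | _) _; set e := 2 ^+ n.
set m := n%:R => ih e0 m0 bme; have := mulr_ge0 m0 e0; lra.
Qed.

(** For positive [n] this is the event [|S| / n >= 1 / (j + 1)], written with fourth powers to suit
    the fourth moment. *)
Definition large_deviation B j n : set cantor_space :=
  [set x | n%:R ^+ 4 <= j.+1%:R ^+ 4 * rademacher_sum B n x ^+ 4].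

Lemma large_deviation_determined B j n : determined n (large_deviation B j n).
Proof.
move=> x y xy; rewrite /large_deviation/=; suff -> : rademacher_sum B n x =
  rademacher_sum B n y by [].
by apply: eq_bigr => k _; rewrite xy.
Qed.

(** Markov's inequality for the fourth moment. The second moment would only give a bound of order
    [1 / n], which is not summable. *)
Lemma large_deviation_measure B j n :
  (mu (large_deviation B j n.+1) <= (3 * j.+1%:R ^+ 4 * n.+1%:R ^- 2)%:E)%E.
Proof.
rewrite (cantor_measure_determined (large_deviation_determined (n := n.+1))).
rewrite lee_fin /word_ratio; set E := large_deviation _ _ _.
rewrite ler_pdivrMr ?exprn_gt0//.
have n0 : 0 < n.+1%:R :> R by rewrite ltr0n.
rewrite -(ler_pM2r (exprn_gt0 4 n0)).
rewrite -sum1_card natr_sum mulr_suml.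
apply: (@le_trans _ _ (\sum_(s : n.+1.-tuple bool) j.+1%:R ^+ 4 *
    rademacher_sum B n.+1 (nth false s) ^+ 4)).
  rewrite big_mkcond/=; apply: ler_sum => s _; case: ifPn => [|_].
    by rewrite mul1r => /set_mem.
  by rewrite mulr_ge0// exprn_even_ge0.
rewrite -mulr_sumr; apply: le_trans.
  by apply: ler_wpM2l (rademacher_moment4 B n.+1).
rewrite le_eqVlt; apply/orP; left; apply/eqP.
by field; rewrite -natr1 in n0 *; lra.
Qed.

Lemma nneseries_inv_sqr_lty (c : R) (u : (\bar R)^nat) : 0 <= c ->
  (forall n, (0 <= u n)%E) -> (forall n, (u n <= (c * n.+1%:R ^- 2)%:E)%E) ->
  (\sum_(n <oo) u n < +oo)%E.
Proof.
move=> c0 u0 uc; apply: (@le_lt_trans _ _ (2 * c)%:E); last by rewrite ltry.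
apply: lime_le; first exact: is_cvg_nneseries.
(* The bound telescopes, because [1 / (m + 1)^2 <= 2 (1 / (m + 1) - 1 / (m + 2))]. *)
near=> n; apply: (@le_trans _ _ (2 * c * (1 - n.+1%:R^-1))%:E); last first.
  by rewrite lee_fin ler_piMr ?mulr_ge0// lerBlDr lerDl invr_ge0.
elim: (n) => [|m ih]; first by rewrite big_nil invr1 subrr mulr0.
rewrite big_nat_recr//=; apply: (le_trans (leeD ih (uc m))).
rewrite -EFinD lee_fin -lerBrDl -!mulrBr.
rewrite (_ : _ - _ = m.+1%:R^-1 - m.+2%:R^-1); last by ring.
have m0 : 0 < m.+1%:R :> R by rewrite ltr0n.
have -> : m.+2%:R = m.+1%:R + 1 :> R by rewrite natr1.
have m1 : 1 <= m.+1%:R :> R by rewrite ler1n.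
move: m0 m1; set a := m.+1%:R => a0 a1.
rewrite [2 * c]mulrC -mulrA ler_wpM2l//.
rewrite (_ : 2 * _ = 2 / (a * (a + 1))); last by field; lra.
rewrite ler_pdivlMr ?mulr_gt0//; last lra.
by rewrite mulrC ler_pdivrMr ?exprn_gt0//; nra.
Unshelve. all: by end_near. Qed.

(** Borel-Cantelli for each tolerance [1 / (j + 1)], then a countable union over [j]. *)
Lemma slln B : cantor_null R
  [set x | ~ (rademacher_sum B n x / n%:R @[n --> \oo] --> (0 : R))].
Proof.
pose E j := lim_sup_set (fun n => large_deviation B j n.+1).
apply: (@cantor_nullS _ (\bigcup_j E j)); last first.
  apply: negligible_bigcup => j.
  have mE n : measurable (large_deviation B j n.+1 :
      set cantor_sigma).
    exact: determined_measurable (@large_deviation_determined B j n.+1).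
  apply/negligibleP.
    by apply: bigcapT_measurable => n; apply: bigcup_measurable.
  apply: lim_sup_set_cvg0 => //.
  apply: (@nneseries_inv_sqr_lty (3 * j.+1%:R ^+ 4)).
  - by rewrite mulr_ge0// exprn_ge0.
  - by move=> n; exact: measure_ge0.
  - by move=> n; exact: large_deviation_measure.
move=> x /= Sx; apply: contrapT => Ex; apply: Sx.
rewrite -cvg_shiftS; apply/cvgr0Pnorm_lt => e e0.
have [j _ /(_ j (leqnn j))/= ej] := near_infty_natSinv_lt (PosNum e0).
have [N NE] : exists N, forall n, (N <= n)%N -> ~ large_deviation B j n.+1 x.
  apply: contrapT => NE; apply: Ex; exists j => // N _.
  apply: contrapT => EN; apply: NE; exists N => n Nn En; apply: EN.
  by exists n.
exists N => // n /= /NE; rewrite /large_deviation/= => /negP.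
rewrite -ltNge => Sn; rewrite normrM normfV normr_nat ltr_pdivrMr ?ltr0n//.
apply: (@le_lt_trans _ _ (j.+1%:R^-1 * n.+1%:R)); last by rewrite ltr_pM2r ?ltr0n.
rewrite ler_pdivlMl ?ltr0n//; set S := rademacher_sum _ _ _ in Sn *.
rewrite -(@ler_pXn2r _ 4)// ?nnegrE ?mulr_ge0//.
by rewrite exprMn (_ : `|S| ^+ 4 = S ^+ 4) ?(ltW Sn)// -normrX ger0_norm// exprn_even_ge0.
Qed.

(** * G_delta sets coded by points of the Cantor space *)

Definition gdelta (t : nat -> bool) : set cantor_space :=
  \bigcap_n \bigcup_(s in [set s | t (@choice.pickle (nat * seq bool)%type (n, s))])
    cylinder s.

(** For each [n], a null measurable set has a cover by clopen sets of total measure below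
    [1 / (n + 1)]. The unions of these covers intersect in a null G_delta set, coded by listing the
    cylinders inside each union. *)
Lemma null_gdelta A : cantor_null R A ->
  exists2 t, cantor_null R (gdelta t) & A `<=` gdelta t.
Proof.
move=> [M [mM M0 AM]].
have /choice[F FP] : forall n, exists F : (set clopen_cantor)^nat,
    measurable_cover (M : set clopen_cantor) F /\
    (\sum_(k <oo) clopen_measure R (F k) < n.+1%:R^-1%:E)%E.
  move=> n; have : (mu_ext (clopen_measure R) M < n.+1%:R^-1%:E)%E.
    rewrite (_ : mu_ext _ _ = 0%E); last exact: M0.
    by rewrite lte_fin invr_gt0 ltr0n.
  by move=> /ereal_inf_lt[_ [F MF <-] Fn]; exists F.
pose t i := if @choice.unpickle (nat * seq bool)%type i is Some (n, s)
  then `[< cylinder s `<=` \bigcup_k F n k >] else false.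
have tE n s : t (@choice.pickle (nat * seq bool)%type (n, s)) =
    `[< cylinder s `<=` \bigcup_k F n k >].
  by rewrite /t choice.pickleK.
have mF n : measurable (\bigcup_k F n k :
    set cantor_sigma).
  apply: bigcup_measurable => k _; apply: sub_sigma_algebra.
  by have [[+ _] _] := FP n; apply.
exists t; last first.
  move=> x /AM Mx n _; have [[mFn /(_ x Mx)[k _ Fkx]] _] := FP n.
  (* Membership in [F n k] depends on the coordinates below [m] only, so the cylinder of the first
     [m] values of [x] lies inside it. *)
  have [m mFk] := mFn k; exists (mkseq x m).
    rewrite /= tE; apply/asboolP => y yx; exists k => //.
    apply: (mFk x) => // i im; apply/esym.
    by rewrite yx ?size_mkseq// nth_mkseq.
  by move=> i; rewrite size_mkseq => im; rewrite nth_mkseq.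
apply: (@cantor_nullS _ (\bigcap_n \bigcup_k F n k)).
  move=> x tx n _; have [s + sx] := tx n I.
  by rewrite /= tE => /asboolP; apply.
apply/negligibleP; first exact: bigcapT_measurable.
apply/eqP; rewrite -measure_le0; apply/lee_addgt0Pr => e e0; rewrite add0e.
have [n _ /(_ n (leqnn n))/= ne] := near_infty_natSinv_lt (PosNum e0).
apply: (@le_trans _ _ (mu (\bigcup_k F n k))).
  by apply: le_measure; rewrite ?inE//;
    [exact: bigcapT_measurable|exact: bigcap_inf].
apply: (@le_trans _ _ n.+1%:R^-1%:E); last by rewrite lee_fin ltW.
have [[mFn _] /ltW] := FP n; apply: le_trans.
by apply: ereal_inf_lbound; exists (F n) => //; split.
Qed.

(** * Invariance of the measure under flipping one coordinate *)

Definition flip k (x : cantor_space) : cantor_space :=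
  fun i => if i == k then ~~ x i else x i.

Lemma flipK k : involutive (flip k).
Proof.
by move=> x; apply/funext => i; rewrite /flip; case: eqP => // _; exact: negbK.
Qed.

Lemma flip_determined k n A : determined n A -> determined n (flip k @^-1` A).
Proof.
move=> nA x y xy; apply: nA => i ilt.
by rewrite /flip; case: eqP => _; rewrite xy.
Qed.

(** Flipping letter [k] permutes the words of length [n]; as [k < n], the continuation by zeros is
    unaffected. *)
Lemma word_ratio_flip k n A : (k < n)%N ->
  word_ratio R n (flip k @^-1` A) = word_ratio R n A.
Proof.
move=> kn; rewrite /word_ratio; congr (_%:R / _).
pose h (s : n.-tuple bool) : n.-tuple bool :=
  [tuple of mkseq (flip k (nth false s)) n].
have hE s : nth false (h s) = flip k (nth false s).
  apply/funext => i /=; have [ilt|nle] := ltnP i n; first by rewrite nth_mkseq.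
  rewrite nth_default ?size_mkseq// /flip gtn_eqF ?(leq_trans kn)//.
  by rewrite nth_default// size_tuple.
have hinj : injective h.
  move=> s s' ss'; apply: val_inj; apply: (@eq_from_nth _ false).
    by rewrite !size_tuple.
  move=> i _; rewrite -[nth false s](flipK k) -[nth false s'](flipK k).
  by rewrite -!hE ss'.
rewrite -!sum1_card [RHS](reindex_inj hinj)/=; apply: eq_bigl => s.
by rewrite !inE hE; apply/idP/idP; rewrite !inE.
Qed.

Lemma measurable_flip k : measurable_fun setT
  (flip k : cantor_sigma ->
            cantor_sigma).
Proof.
apply: (@measurability _ _ cantor_sigma cantor_sigma setT (flip k)
  (@measurable _ clopen_cantor)) => //.
move=> _ [A [n nA] <-]; rewrite setTI.
exact: determined_measurable (flip_determined nA).
Qed.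

(** The image measure under the flip has the same values on clopen sets, so uniqueness of the
    extension applies. *)
Lemma cantor_measure_flip k
    (A : set cantor_sigma) :
  measurable A -> mu (flip k @^-1` A) = mu A.
Proof.
move=> mA; apply/esym.
pose nu : {measure set cantor_sigma -> \bar R} :=
  measure_function_pushforward__canonical__measure_function_Measure
    mu (measurable_flip k).
apply: (@measure_extension_unique _ _ _ (clopen_measure R) _ nu) => //.
  exists (fun=> setT); first by rewrite bigcup_const//; exists 0%N.
  move=> _; split; first by exists 0%N.
  by rewrite /= /clopen_measure ltry.
move=> X [n nX].
have nX' : determined (maxn n k.+1) X.
  by apply: determined_le nX; exact: leq_maxl.
rewrite /nu/= /pushforward/=.
rewrite (cantor_measure_determined (flip_determined nX')).
by rewrite word_ratio_flip ?leq_maxr// (clopen_measureE R nX').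
Qed.

(** All the flipped sets have the measure of [A], so [n * mu A <= 1] for every [n]. *)
Lemma disjoint_flips_null
    (A : set cantor_sigma) :
  measurable A -> (forall j k, j != k -> flip j @^-1` A `&` flip k @^-1` A = set0) ->
  mu A = 0%E.
Proof.
move=> mA Adisj.
have mfA k : measurable (flip k @^-1` A :
    set cantor_sigma).
  by rewrite -[_ @^-1` _]setTI; exact: measurable_flip.
have tA : trivIset setT (fun k => flip k @^-1` A).
  by apply/trivIsetP => j k _ _; exact: Adisj.
have muA1 : (mu A <= 1)%E.
  by rewrite -cantor_measureT; apply: le_measure; rewrite ?inE.
have fA : mu A \is a fin_num.
  by rewrite ge0_fin_numE// (le_lt_trans muA1)// ltry.
rewrite -(fineK fA); congr EFin; apply/eqP; rewrite eq_le fine_ge0// andbT leNgt.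
apply/negP => a0.
have nA n : n%:R * fine (mu A) <= 1.
  rewrite -lee_fin EFinM fineK// -cantor_measureT.
  have -> : (n%:R%:E * mu A = mu (\big[setU/set0]_(i < n) (flip i @^-1` A)))%E.
    rewrite (measure_bigsetU mu mfA tA).
    rewrite (eq_bigr (fun=> mu A)) => [|i _]; last exact: cantor_measure_flip.
    by rewrite sumr_const card_ord mule_natl.
  by apply: le_measure; rewrite ?inE//; exact: bigsetU_measurable.
have := nA (Num.truncn (fine (mu A))^-1).+1.
rewrite leNgt -ltr_pdivrMr// div1r => /negP; apply.
exact: truncnS_gt.
Qed.

End cantor_measure_theory.

(** * A well-order of the continuum *)

Section well_order.
Variable T : Type.

Lemma well_order_lt : exists lt : T -> T -> Prop, [/\ well_founded lt,
  (forall x y z, lt x y -> lt y z -> lt x z) &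
  (forall x y, [\/ lt x y, x = y | lt y x])].
Proof.
have [R wo] := well_ordering_principle {classic T}.
have woT : wo_chain R predT by apply: withinW.
have Rtot x y : R x y || R y x by apply: (wo_chainW woT).
have Ranti x y : R x y -> R y x -> x = y.
  by move=> xy yx; apply: (wo_chain_antisymmetric woT) => //; rewrite xy.
have Rtr x y z : R x y -> R y z -> R x z.
  (* Transitivity is read off from the least element of [{x, y, z}]. *)
  move=> xy yz; have [|m [[+ mle] _]] := wo (mem [:: x; y; z]).
    by exists x; rewrite inE eqxx.
  rewrite !inE => /or3P[] /eqP me; rewrite {m}me in mle.
  - by apply: mle; rewrite !inE eqxx !orbT.
  - have yx : R y x by apply: mle; rewrite !inE eqxx.
    by rewrite (Ranti x y).
  - have zy : R z y by apply: mle; rewrite !inE eqxx orbT.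
    by rewrite (Ranti z y).
exists (fun x y => R x y /\ x <> y); split.
- move=> x; apply: contrapT => Nx.
  have [|z [[/= /asboolP Nz zle] _]] :=
    wo (fun y => `[< ~ Acc (fun x y => R x y /\ x <> y) y >]).
    by exists x; apply/asboolP.
  apply: Nz; constructor => y [yz neq]; apply: contrapT => Ny; apply: neq.
  by apply: Ranti => //; apply: zle; apply/asboolP.
- move=> x y z [xy neq] [yz _]; split; first exact: Rtr yz.
  by move=> xz; apply: neq; apply: Ranti => //; rewrite xz.
- move=> x y; have [->|neq] := pselect (x = y); first by constructor 2.
  by have /orP[xy|yx] := Rtot x y; [constructor 1|constructor 3; split=> // /esym].
Qed.

(** Only the values below [x] matter to [P x], so at stage [x] the earlier choices are extended to a
    total function by the default [u0]. *)
Lemma well_founded_choice (lt : T -> T -> Prop) (U : Type) (u0 : U)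
    (P : T -> (T -> U) -> U -> Prop) :
  well_founded lt ->
  (forall x f g u, (forall y, lt y x -> f y = g y) -> P x f u -> P x g u) ->
  (forall x f, exists u, P x f u) -> exists f, forall x, P x f (f x).
Proof.
move=> wf Pext Pex.
pose ext x (h : forall y, lt y x -> U) y :=
  if pselect (lt y x) is left p then h y p else u0.
pose F x h := sval (cid (Pex x (@ext x h))).
exists (Fix wf (fun=> U) F) => x.
rewrite Fix_eq; last first.
  move=> y h h' hh'; congr F.
  by apply: functional_extensionality_dep => z; apply: functional_extensionality_dep.
rewrite {2}/F; case: cid => u /=; apply: Pext => y yx; rewrite /ext.
by case: pselect.
Qed.

End well_order.

(** * Finite binary trees with labelled leaves *)

Section trees.
Variable T : Type.
Implicit Types Y : set T.

Inductive tree := Nil | Leaf of T | Node of tree & tree.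

Fixpoint leaves (w : tree) : set T :=
  match w with
  | Nil => set0
  | Leaf t => [set t]
  | Node a b => leaves a `|` leaves b
  end.

Definition trees Y : set tree := [set w | leaves w `<=` Y].

Lemma trees_subset Y Y' : Y `<=` Y' -> trees Y `<=` trees Y'.
Proof. by move=> YY' w; rewrite /trees/= => wY; exact: subset_trans YY'. Qed.

Definition tree_of_seq : seq tree -> tree := foldr Node Nil.

Lemma tree_of_seq_inj : injective tree_of_seq.
Proof. by elim=> [|a s ih] [|b t]//= [-> /ih ->]. Qed.

Lemma tree_of_seq_trees Y s :
  (forall w, List.In w s -> trees Y w) -> trees Y (tree_of_seq s).
Proof.
elim: s => [_ //|a s ih sY]; rewrite /trees/= subUset; split.
  by apply: sY; left.
by apply: ih => w ws; apply: sY; right.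
Qed.

(* The image of a node has a node as left child, so that [Node Nil Nil] is free
   to stand for [Leaf z]. *)
Fixpoint prune z (w : tree) : tree :=
  match w with
  | Nil => Nil
  | Leaf t => if pselect (t = z) then Node Nil Nil else Leaf t
  | Node a b => Node (Node (prune z a) (prune z b)) Nil
  end.

Lemma prune_inj z : injective (prune z).
Proof.
elim=> [|t|a iha b ihb] [|t'|a' b'] //=; do ?by case: pselect.
- by case: pselect => tz; case: pselect => t'z //=; do ?[case=> ->]; rewrite ?tz ?t'z.
- by case=> /iha -> /ihb ->.
Qed.

Lemma prune_trees z Y w : trees (z |` Y) w -> trees Y (prune z w).
Proof.
elim: w => [|t|a iha b ihb]; rewrite /trees/=; first by move=> _ t.
  move=> /(_ t erefl) zYt; case: pselect => [_|tz] /=; first by rewrite setU0.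
  by case: zYt => [//|Yt] _ ->.
rewrite !subUset => -[/iha aY /ihb bY].
by split=> //; split.
Qed.

Fixpoint tree_code (w : tree) : nat :=
  match w with
  | Nil | Leaf _ => 0
  | Node a b => (choice.pickle (tree_code a, tree_code b)).+1
  end.

(** A tree over the empty set is a bare shape, which iterated pairing of natural numbers codes. *)
Lemma tree_code_inj : {in trees set0 &, injective tree_code}.
Proof.
move=> w w' /set_mem + /set_mem.
elim: w w' => [|t|a iha b ihb] [|t'|a' b'] //; rewrite /trees/=;
  do ?[by move=> /(_ t erefl)|by move=> _ /(_ t' erefl)].
rewrite !subUset => -[a0 b0] [a0' b0'] [/(pcan_inj choice.pickleK)[]].
by move=> /iha -> // /ihb ->.
Qed.

End trees.
Arguments Nil {T}.

Lemma card_le_inj T U (A : set T) (B : set U) (f : T -> U) :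
  {in A &, injective f} -> f @` A `<=` B -> (A #<= B)%card.
Proof.
move=> fi fAB; apply: card_le_trans (subset_card_le fAB).
by have := inj_card_eq fi; rewrite card_eq_le => /andP[].
Qed.

Lemma continuum_uncountable : ~ countable continuum.
Proof.
move=> /(card_le_trans (card_lexx _)) h.
have /surjPex[g gs] : $|{surj [set: nat] >-> continuum}| by apply/pcard_geP.
have [n _ gn] := gs (fun n => ~~ g n n) I.
by have := congr1 (@^~ n) gn; case: (g n n).
Qed.

(* Trees with leaves in [Y] replace subsets of [Y] in order to avoid the cardinal
   arithmetic k * k = k: sequences of trees over [Y] are coded by trees over [Y].
   In a well-order of the continuum, [J] is the initial segment of those [x] such
   that there are fewer than c trees over [le x]; the order is one on the trees
   over [J] that compares first a bound in [J] of the leaves. *)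
Lemma continuum_well_order : exists (I : Type) (lt : I -> I -> Prop),
  [/\ well_founded lt,
      (forall i j k, lt i j -> lt j k -> lt i k),
      (forall i j, [\/ lt i j, i = j | lt j i]),
      (continuum #<= [set: I])%card &
      forall i, ~ (continuum #<= [set l : seq I | forall j, List.In j l -> lt j i])%card].
Proof.
have [lt [ltwf lttr lttot]] := well_order_lt (nat -> bool).
pose le x := [set y | lt y x \/ y = x].
have lele x y : lt x y -> le x `<=` le y.
  by move=> xy z [zx|->]; left => //; exact: lttr xy.
pose J := [set x | ~ (continuum #<= trees (le x))%card].
(* If [J] is not everything, let [z] be least outside it. There are at least c trees over [le z],
   and pruning the leaves [z] injects them into the trees over the points below [z], all of which
   are in [J]. *)
have cJ : (continuum #<= trees J)%card.
  have [JT|NJ] := pselect (J = setT).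
    apply: (@card_le_inj _ _ _ _ (@Leaf _)) => [x y _ _ [//]|_ [x _ <-]].
    by rewrite JT.
  have {}NJ : exists z, ~ J z.
    apply: contrapT => NJz; apply: NJ; apply/seteqP; split=> // x _.
    by apply: contrapT => Jx; apply: NJz; exists x.
  have [z Nz zmin] : exists2 z, ~ J z & forall y, lt y z -> J y.
    case: NJ => z; elim/(well_founded_ind ltwf): z => z ih Nz.
    have [[y yz Ny]|zmin] := pselect (exists2 y, lt y z & ~ J y).
      exact: ih yz Ny.
    by exists z => // y yz; apply: contrapT => Ny; apply: zmin; exists y.
  have {}Nz : (continuum #<= trees (le z))%card by apply: contrapT.
  apply: card_le_trans Nz _.
  apply: (@card_le_inj _ _ _ _ (prune z)) => [w w' _ _|_ [w wz <-]].
    exact: prune_inj.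
  apply: trees_subset zmin _ _; apply: prune_trees.
  by apply: trees_subset wz => y [yz|->]; [right|left].
have [x0 Jx0] : J !=set0.
  apply/set0P/eqP => J0; apply: continuum_uncountable.
  rewrite J0 in cJ; apply: card_le_trans cJ _.
  exact: (card_le_inj (@tree_code_inj _)).
(* A tree has finitely many leaves, so a bound is found by taking maxima, starting from [x0] at
   [Nil]. *)
have /choice[rank rankP] : forall w : trees J, exists x, J x /\ trees (le x) (val w).
  move=> [/= w /set_mem]; elim: w => [|x|a iha b ihb]; rewrite /trees/=.
  - by exists x0; split=> // t.
  - by move=> /(_ x erefl) Jx; exists x; split=> // y ->; right.
  - rewrite subUset => -[/iha[x [Jx xa]] /ihb[y [Jy yb]]].
    have [xy|xy|yx] := lttot x y.
    + by exists y; split=> //; rewrite subUset; split=> //;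
        apply: subset_trans (lele _ _ xy).
    + by exists y; split=> //; rewrite subUset -{1}xy.
    + by exists x; split=> //; rewrite subUset; split=> //;
        apply: subset_trans (lele _ _ yx).
have [ltI [ltIwf ltItr ltItot]] := well_order_lt (trees J).
exists (trees J), (fun i j => lt (rank i) (rank j) \/
  (rank i = rank j /\ ltI i j)); split.
- move=> i; move: {2}(rank i) (erefl (rank i)) => r.
  elim/(well_founded_ind ltwf): r i => r ihr i.
  elim/(well_founded_ind ltIwf): i => i ihi ri; constructor => j [jr|[jr ji]].
    by apply: (ihr (rank j)) => //; rewrite -ri.
  by apply: ihi => //; rewrite jr.
- move=> i j k [ij|[eij ij]] [jk|[ejk jk]].
  + by left; exact: lttr jk.
  + by left; rewrite -ejk.
  + by left; rewrite eij.
  + by right; split; [rewrite eij|exact: ltItr jk].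
- move=> i j; have [ij|eij|ji] := lttot (rank i) (rank j).
  + by constructor 1; left.
  + have [ij|ij|ji] := ltItot i j.
    * by constructor 1; right.
    * by constructor 2.
    * by constructor 3; right.
  + by constructor 3; left.
- apply: card_le_trans cJ _.
  by have := card_setT (trees J); rewrite card_eq_le => /andP[].
(* Every member of a list below [i] has its leaves in [le (rank i)], so one tree over this segment
   codes the list; since [rank i] is in [J], there are fewer than c such trees. *)
- move=> i ci; have [Ji _] := rankP i; apply: Ji.
  apply: card_le_trans ci _.
  apply: (@card_le_inj _ _ _ _ (fun l => tree_of_seq (map val l))).
    move=> l l' _ _ /tree_of_seq_inj; exact: inj_map val_inj _ _.
  move=> _ [l /= il <-]; apply: tree_of_seq_trees => w.
  elim: l il => //= j l ih il [<-|]; last by apply: ih => k kl; apply: il; right.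
  have [_ jr] := rankP j; have [ji|[<- _]//] := il j (or_introl erefl).
  exact: trees_subset (lele _ _ ji) _ jr.
Qed.

(** * A non-null independent family *)

Section non_null_family.
Variable R : realType.

Definition not_equidistributed (B : set nat) : set cantor_space :=
  [set x | ~ (rademacher_sum R B n x / n%:R @[n --> \oo] --> (0 : R))].

Lemma charfun_inj : injective charfun.
Proof.
move=> A B AB; apply/seteqP; split=> k kA.
  by have := congr1 (@^~ k) AB; rewrite /charfun (mem_set kA) => /esym/set_mem.
by have := congr1 (@^~ k) AB; rewrite /charfun (mem_set kA) => /set_mem.
Qed.

Lemma charfunK (x : cantor_space) : charfun [set k | x k] = x.
Proof. by apply/funext => k; apply/idP/idP; rewrite inE. Qed.

(** The indicator of the intersection is half the sum of the indicator of [B] and the signs of [A]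
    along [B], and these signs average to 0. *)
Lemma cvg_density_half (A B : set nat) (b : R) :
  ~ not_equidistributed B (charfun A) -> cvg_density B b ->
  cvg_density (A `&` B) (b / 2).
Proof.
move=> /contrapT AB Bb; rewrite /cvg_density.
have -> : density_seq R (A `&` B) =
    (density_seq R B \+ (fun n => rademacher_sum R B n (charfun A) / n%:R)) \*
    cst 2^-1.
  apply/funext => n /=; rewrite !density_seqE -mulrDl mulrAC; congr (_ / _).
  rewrite /rademacher_sum [X in _ + X]big_mkcond -big_split/= mulr_suml.
  apply: eq_bigr => k _; rewrite in_setI /charfun /rademacher.
  by case: (_ \in A); case: (_ \in B) => /=; lra.
by rewrite -[b]addr0; apply: cvgM; [exact: cvgD|exact: cvg_cst].
Qed.

(** * Transfinite choice of the independent sets *)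

Section recursion.
Variables (I : Type) (lt : I -> I -> Prop) (e : I -> nat -> bool).
Hypothesis lt_wf : well_founded lt.
Hypothesis lt_trans : forall i j k, lt i j -> lt j k -> lt i k.
Hypothesis lt_total : forall i j, [\/ lt i j, i = j | lt j i].
Hypothesis lt_seq : forall i,
  ~ (continuum #<= [set l : seq I | forall j, List.In j l -> lt j i])%card.
Hypothesis cov : card_is_cov_null R continuum.

(** Indexing the intersections by lists lets [lt_seq] bound the number of requirements at a
    stage. *)
Definition seq_cap (f : I -> set nat) (l : seq I) : set nat :=
  foldr (fun j A => f j `&` A) setT l.

(** Codes of non-null sets are sent to the empty set, so that what stage [i] must avoid is always
    null. *)
Definition null_gdelta_set i : set cantor_space :=
  if `[< cantor_null R (gdelta (e i)) >] then gdelta (e i) else set0.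

Definition random_over i (f : I -> set nat) (A : set nat) :=
  ~ null_gdelta_set i (charfun A) /\
  forall l, (forall j, List.In j l -> lt j i) ->
    ~ not_equidistributed (seq_cap f l) (charfun A).

(** The excluded sets are null and indexed by the lists below [i]; these are fewer than c = cov(N),
    so they do not cover the space. *)
Lemma random_over_exists i f : exists A, random_over i f A.
Proof.
pose L := [set l : seq I | forall j, List.In j l -> lt j i].
(* Joining the G_delta set to every member keeps the family indexed by lists alone; the empty list
   guarantees that it occurs. *)
pose N l := null_gdelta_set i `|` not_equidistributed (seq_cap f l).
have [x Nx] : exists x, ~ (\bigcup_(X in N @` L) X) x.
  apply: contrapT => Nx; apply: (lt_seq (i := i)).
  apply: card_le_trans (card_image_le N L); apply: cov.2; split.
    move=> _ [l _ <-]; apply: cantor_null_setU; last exact: slln.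
    by rewrite /null_gdelta_set; case: asboolP => // _; exact: cantor_null0.
  by apply/seteqP; split=> // x _; apply: contrapT => xN; apply: Nx; exists x.
exists [set k | x k]; rewrite /random_over charfunK; split=> [xN|l Ll xN].
  by apply: Nx; exists (N [::]); [exists [::]|left].
by apply: Nx; exists (N l); [exists l|right].
Qed.

Lemma random_family : exists f, forall i, random_over i f (f i).
Proof.
apply: (well_founded_choice set0 lt_wf) => [i f g A fg [Af fA]|i f].
  split=> // l Ll; have -> : seq_cap g l = seq_cap f l; last exact: fA.
  elim: l Ll => //= j l ih Ll; rewrite ih => [|k kl]; last by apply: Ll; right.
  by rewrite fg//; apply: Ll; left.
exact: random_over_exists.
Qed.

Variable f : I -> set nat.
Hypothesis f_random : forall i, random_over i f (f i).

Lemma fcap_seq_cap i F : [set` F] `<=` f @` [set j | lt j i] ->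
  exists2 l, (forall j, List.In j l -> lt j i) & fcap F = seq_cap f l.
Proof.
elim/fset1U_rect: F => [_|A F AF ih AFi]; first by exists [::] => //; exact: fcap0.
have [|l li Fl] := ih; first by move=> B BF; apply: AFi; rewrite /= in_fsetU BF orbT.
have [|j ji <-] := AFi A; first by rewrite /= fset1U1.
by exists (j :: l); [move=> k [<-//|/li]|rewrite fcapU fcap1 Fl].
Qed.

Lemma random_indep_extend i : indep R (f @` [set j | lt j i]) ->
  indep R (f i |` f @` [set j | lt j i]).
Proof.
move=> iF; apply: indep_extend => // F FF.
apply: cvg_density_half; last by rewrite (cvg_densityE (iF.2 F FF)); exact: iF.2.
by have [l li ->] := fcap_seq_cap FF; exact: (f_random i).2.
Qed.

(** The image of [D] is the union of a chain of independent sets, each adjoining one [f i] to all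
    earlier values. *)
Lemma random_indep_downset (D : set I) : (forall i j, D i -> lt j i -> D j) ->
  (forall i, D i -> indep R (f @` [set j | lt j i])) -> indep R (f @` D).
Proof.
move=> Ddown iD; pose C := [set f i |` f @` [set j | lt j i] | i in D].
have -> : f @` D = \bigcup_(X in C) X.
  apply/seteqP; split=> [_ [i Di <-]|_ [_ [i Di <-] [->|[j ji <-]]]].
  - by exists (f i |` f @` [set j | lt j i]); [exists i|left].
  - by exists i.
  - by exists j => //; exact: Ddown ji.
apply: indep_bigcup => [_ _ [i Di <-] [j Dj <-]|_ [i Di <-]]; last first.
  by apply: random_indep_extend; exact: iD.
have sub i' j' : lt i' j' ->
    f i' |` f @` [set j | lt j i'] `<=` f j' |` f @` [set j | lt j j'].
  move=> ij A [->|[k ki <-]]; right; first by exists i'.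
  by exists k => //; exact: lt_trans ij.
have [ij|->|ji] := lt_total i j; [left; exact: sub|by left|right; exact: sub].
Qed.

Lemma random_indep : indep R (range f).
Proof.
(* The downset lemma serves twice: for the whole index set, and for each initial segment in the
   induction. *)
apply: random_indep_downset => // i _; elim/(well_founded_ind lt_wf): i => i ih.
by apply: random_indep_downset => [j k ji kj|j ji]; [exact: lt_trans ji|exact: ih].
Qed.

(** If [f j] equalled an earlier [f i], it would contain only half of itself: its density d would
    satisfy d = d / 2, against d > 0. *)
Lemma random_injective : injective f.
Proof.
have neq i j : lt i j -> f i <> f j.
  move=> ij fij; have di := indep_density random_indep (imageT f i).
  have : cvg_density (f j `&` seq_cap f [:: i]) (density R (f i) / 2).
    apply: cvg_density_half; last by rewrite /= setIT.
    by apply: (f_random j).2 => k [<-|].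
  rewrite /= setIT -fij setIid => /cvg_densityE.
  by have [/(_ _ (imageT f i))/andP[d0 _] _] := random_indep; lra.
move=> i j fij; have [/neq//|//|/neq] := lt_total i j.
by move=> /(_ (esym fij)).
Qed.

(** A null G_delta set around the family would have a code [e i], but [f i] avoids that set. *)
Lemma random_non_null : set_surj [set: I] continuum e ->
  ~ cantor_null R (charfun @` range f).
Proof.
move=> esurj /null_gdelta[t tnull ft]; have [i _ eit] := esurj t Logic.I.
have := (f_random i).1; rewrite /null_gdelta_set eit.
case: asboolP => // _; apply; apply: ft; exists (f i) => //; exact: imageT.
Qed.

End recursion.

Lemma measurable_indep_null (AA : set (set nat)) : indep R AA ->
  cantor_lebesgue_measurable R (charfun @` AA) -> cantor_null R (charfun @` AA).
Proof.
move=> iAA [A mA [N nN AN]]; rewrite -AN.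
apply: cantor_null_setU => //; apply/(negligibleP _ mA).
have AAA x : A x -> exists2 a, AA a & charfun a = x.
  by move=> Ax; have : (A `|` N) x by [left]; rewrite AN.
(* A common point of two flipped sets yields two members of [AA] that differ exactly at [j] and
   [k]. *)
apply: disjoint_flips_null => // j k jk; rewrite -subset0 => x.
move=> [/AAA[a aAA ajx] /AAA[b bAA bkx]].
have ab : a != b.
  apply/eqP => ab; have := congr1 (@^~ j) ajx; rewrite ab bkx /flip eqxx.
  by rewrite (negbTE jk); case: (x j).
apply: (@indep_neq_eventually R AA a b (maxn j k).+1 iAA aAA bAA ab) => i.
rewrite gtn_max => /andP[ji ki].
have -> : (i \in a) = charfun a i by [].
have -> : (i \in b) = charfun b i by [].
by rewrite ajx bkx /flip !gtn_eqF.
Qed.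

End non_null_family.

Theorem theorem2p15 (R : realType) :
  card_is_cov_null R continuum ->
  exists AA : set (set nat),
    [/\ maximal_d_independent R AA,
        (AA #= continuum)%card &
        ~ cantor_lebesgue_measurable R (charfun @` AA)].
Proof.
move=> cov.
have [I [lt [ltwf lttr lttot cI ltseq]]] := continuum_well_order.
have /surjPex[e esurj] : $|{surj [set: I] >-> continuum}| by apply/pcard_geP.
have [f frandom] := random_family e ltwf ltseq cov.
have f0 : range f !=set0.
  by have [i _ _] := esurj (fun=> true) Logic.I; exists (f i); exact: imageT.
have [AA mAA fAA] := indep_maximal f0 (random_indep ltwf lttr lttot frandom).
have [_ iAA] := (indepP R AA).1 mAA.1.
exists AA; split=> //.
  rewrite card_eq_le; apply/andP; split.
    by apply: (@card_le_inj _ _ _ _ charfun) => // A B _ _; exact: charfun_inj.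
  apply: card_le_trans cI _.
  apply: (@card_le_inj _ _ _ _ f) => // i j _ _.
  exact: (random_injective ltwf lttr lttot frandom).
move=> /(measurable_indep_null iAA) nAA.
apply: (random_non_null frandom esurj); apply: cantor_nullS nAA.
exact: image_subset.
Qed.
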